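(* Let $y$ be a Lyndon word of length $n>1$ over a totally ordered alphabet. Run Algorithm LeftLyndonTree (described in the context) on $y$. Then the algorithm creates exactly the $n-1$ internal nodes of the left Lyndon tree $\mathrm{LLT}(y)$, and the order in which it creates them is the order of their associated prefixes under the infinite ordering $\prec$: if node $q$ is created before node $q'$, then the prefix associated with $q$ is $\prec$-smaller than the prefix associated with $q'$. Equivalently, listing the internal nodes in creation order lists the proper non-empty prefixes of $y$ in strictly $\prec$-increasing order.
   Context: Words are finite sequences $y=y[0]y[1]\cdots y[n-1]$ over a totally ordered alphabet. $y[i\,..\,j]$ denotes the factor $y[i]\cdots y[j]$. Lexicographic order $<$: $u<v$ if $u$ is a proper prefix of $v$, or $u=ras$, $v=rbt$ for words $r,s,t$ and letters $a<b$. Lyndon word: a non-empty word $w$ such that $w<v$ for every proper non-empty suffix $v$ of $w$. Infinite ordering: $u^\infty$ is the infinite word $uuu\cdots$, compared lexicographically. For non-empty words $u,v$, $u\prec v$ iff $u^\infty<v^\infty$, or $u^\infty=v^\infty$ and $|u|>|v|$. Left Lyndon tree $\mathrm{LLT}(y)$ of a Lyndon word $y$: if $|y|=1$ it is a single leaf; otherwise write $y=uv$ where $u$ is the longest proper prefix of $y$ that is a Lyndon word (then $v$ is a Lyndon word), and $\mathrm{LLT}(y)$ is a root whose left subtree is $\mathrm{LLT}(u)$ and right subtree is $\mathrm{LLT}(v)$. The leaves, read left to right, are identified with the positions $0,1,\dots,n-1$ of $y$. Each internal node spans a factor $y[s\,..\,t]$ whose left child spans $y[s\,..\,m]$ for some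 $m$ with $s\le m<t$; the prefix associated with this internal node is $y[0\,..\,m]$. This gives a bijection between internal nodes and proper non-empty prefixes of $y$. Algorithm LeftLyndonTree (input: Lyndon word $y$ of length $n$; arrays lyns, root indexed by positions; internal nodes are fresh identifiers $\ge n$ with left and right child pointers): lyns[0] ← 1; root[0] ← 0; per ← 1; i ← 0. For j = 1 to n−1: root[j] ← j; if y[j] ≠ y[i] then { lyns[j] ← j+1; per ← j+1; i ← 0 } else { lyns[j] ← lyns[i]; i ← (i+1) mod per }; ℓ ← 1; k ← j−1; while ℓ < lyns[j]: { create a new internal node q with left child root[k] and right child root[j]; root[j] ← q; ℓ ← ℓ + lyns[k]; k ← k − lyns[k] }. Return root[n−1] (the root of the constructed binary tree). *)

(* Defs.v *)
From HB Require Import structures.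
From mathcomp Require Import all_boot all_order.
Set Implicit Arguments. Unset Strict Implicit. Unset Printing Implicit Defensive.
Import Order.TTheory.
Local Open Scope order_scope.

Section Words.
Variables (d : Order.disp_t) (T : orderType d).

Fixpoint lexlt (u v : seq T) : bool :=
  match u, v with
  | [::], _ :: _ => true
  | _, [::] => false
  | a :: u', b :: v' => (a < b) || ((a == b) && lexlt u' v')
  end.

Definition lyndon (w : seq T) : bool :=
  (0 < size w)%N && all (fun i => lexlt w (drop i w)) (iota 1 (size w).-1).

(* Letter at position i of u^oo (u non-empty). *)
Definition inf_at (u : seq T) (i : nat) : option T := onth u (i %% size u).

Definition inf_eq (u v : seq T) : Prop := forall i, inf_at u i = inf_at v i.

Definition inf_lt (u v : seq T) : Prop :=
  exists k, (forall i, (i < k)%N -> inf_at u i = inf_at v i) /\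
    exists a b, inf_at u k = Some a /\ inf_at v k = Some b /\ a < b.

Definition prec (u v : seq T) : Prop :=
  inf_lt u v \/ (inf_eq u v /\ (size v < size u)%N).

End Words.

(* Binary trees whose leaves are labelled by positions. *)
Inductive tree := Leaf of nat | Node of tree & tree.

Fixpoint eqt (t1 t2 : tree) : bool :=
  match t1, t2 with
  | Leaf a, Leaf b => a == b
  | Node l r, Node l' r' => eqt l l' && eqt r r'
  | _, _ => false
  end.

Lemma eqtP : Equality.axiom eqt.
Proof.
elim=> [a|l IHl r IHr] [b|l' r'] /=; try by constructor.
  by apply: (iffP eqP) => [->|[]].
apply: (iffP andP) => [[/IHl -> /IHr ->] //|[<- <-]].
by split; [apply/IHl|apply/IHr].
Qed.

HB.instance Definition _ := hasDecEq.Build tree eqtP.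

Fixpoint rightmost (t : tree) : nat :=
  match t with Leaf i => i | Node _ r => rightmost r end.

Fixpoint internals (t : tree) : seq tree :=
  match t with
  | Leaf _ => [::]
  | Node l r => t :: (internals l ++ internals r)
  end.

Section LLT.
Variables (d : Order.disp_t) (T : orderType d).

Definition assoc_prefix (y : seq T) (t : tree) : seq T :=
  match t with Leaf _ => [::] | Node l _ => take (rightmost l).+1 y end.

Definition longest_lyndon_prefix (y : seq T) : nat :=
  \max_(1 <= m < size y | lyndon (take m y)) m.

(* Left Lyndon tree of the factor y, whose first letter is at position off. *)
Fixpoint llt_rec (fuel off : nat) (y : seq T) : tree :=
  match fuel with
  | 0 => Leaf off
  | f.+1 =>
    if (size y <= 1)%N then Leaf off
    else let m := longest_lyndon_prefix y in
         Node (llt_rec f off (take m y)) (llt_rec f (off + m) (drop m y))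
  end.

Definition LLT (y : seq T) : tree := llt_rec (size y) 0 y.

Definition upd {A} (f : nat -> A) (x : nat) (v : A) : nat -> A :=
  fun z => if z == x then v else f z.

(* The while loop; created nodes are appended to cr in creation order.
   Fuel: the loop runs at most j times since l grows by lyns[k] >= 1. *)
Fixpoint while_loop (fuel : nat) (lyns : nat -> nat) (root : nat -> tree)
    (j l k : nat) (cr : seq tree) : (nat -> tree) * seq tree :=
  match fuel with
  | 0 => (root, cr)
  | f.+1 =>
    if (l < lyns j)%N then
      let q := Node (root k) (root j) in
      while_loop f lyns (upd root j q) j (l + lyns k) (k - lyns k) (rcons cr q)
    else (root, cr)
  end.

Record alg_state := AlgState {
  st_lyns : nat -> nat; st_root : nat -> tree;
  st_per : nat; st_i : nat; st_created : seq tree }.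

Definition alg_step (y : seq T) (st : alg_state) (j : nat) : alg_state :=
  let: AlgState lyns root per i cr := st in
  let root1 := upd root j (Leaf j) in
  let: (lyns', per', i') :=
    if onth y j != onth y i then (upd lyns j j.+1, j.+1, 0)
    else (upd lyns j (lyns i), per, (i + 1) %% per) in
  let: (root2, cr') := while_loop j.+1 lyns' root1 j 1 j.-1 cr in
  AlgState lyns' root2 per' i' cr'.

Definition left_lyndon_tree_alg (y : seq T) : tree * seq tree :=
  let st0 := AlgState (upd (fun _ => 0) 0 1) (upd (fun z => Leaf z) 0 (Leaf 0))
                      1 0 [::] in
  let st := foldl (alg_step y) st0 (iota 1 (size y).-1) in
  (st_root st (size y).-1, st_created st).

End LLT.

(* Main.v *)
Require Import Defs.
From HB Require Import structures.
From mathcomp Require Import all_boot all_order.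
From mathcomp Require Import zify.
Set Implicit Arguments. Unset Strict Implicit. Unset Printing Implicit Defensive.
Import Order.TTheory.

(** In a prefix [y[0..j]] of a Lyndon word, the boundaries of the Lyndon factorization are
    exactly the starting positions of its borders; in particular the longest Lyndon suffix
    is the shortest non-empty border, which is what [lyns[j]] measures.  So the inner loop
    walks down the boundaries [m] of [y[0..j-1]], and the node it creates for [m] is the
    one associated with [y[0..m-1]]; its step [j] is the first at which [m] is no longer a
    period, that is, the first position where [y] exceeds the infinite power of
    [y[0..m-1]].  Of two prefixes, the one whose power is left earlier by [y] has the
    smaller power; for prefixes treated in the same step, the shorter is a period of the
    longer, and the longer is then the smaller for the infinite order. *)

(** * Periods, shortest borders and first mismatches *)

Section Periods.
Variables (d : Order.disp_t) (T : orderType d).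
Implicit Types (Y : nat -> T) (u v w y : seq T).

Definition period Y (p n : nat) : bool := [forall t : 'I_(n - p), Y (p + t) == Y t].

Lemma periodP Y p n :
  reflect (forall t, p + t < n -> Y (p + t) = Y t) (period Y p n).
Proof.
apply: (iffP forallP) => [h t lt|h t]; last by apply/eqP/h; have := ltn_ord t; lia.
have lt' : t < n - p by lia.
exact: (eqP (h (Ordinal lt'))).
Qed.

Lemma periodPn Y p n : ~~ period Y p n ->
  exists t, [/\ p + t < n, forall r, r < t -> Y (p + r) = Y r & Y (p + t) <> Y t].
Proof.
case/forallPn => t0 neq0.
have ex : exists t, Y (p + t) != Y t by exists t0.
case: (ex_minnP ex) => t /eqP neq tmin; exists t; split=> //.
  by have := tmin _ neq0; have := ltn_ord t0; lia.
by move=> r lt; apply/eqP; apply: contraTT lt => /tmin; rewrite -leqNgt.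
Qed.

Lemma period_sub Y p n n' : n' <= n -> period Y p n -> period Y p n'.
Proof. by move=> le /periodP h; apply/periodP => t lt; apply: h; lia. Qed.

Lemma period_mod Y p n i : 0 < p -> period Y p n -> i < n -> Y i = Y (i %% p).
Proof.
move=> p0 /periodP per; elim/ltn_ind: i => i IH lt.
have [ltp|lep] := ltnP i p; first by rewrite modn_small.
rewrite -{1}(subnKC lep) per ?subnKC // IH; [|lia..].
by rewrite -{2}(subnK lep) modnDr.
Qed.

(* Starting position of the shortest non-empty border of [Y 0 .. Y k]. *)
Definition last_border Y k := \max_(p < k.+1 | period Y p k.+1) p.

Lemma last_borderP Y k :
  [/\ last_border Y k <= k, period Y (last_border Y k) k.+1 &
      forall p, p <= k -> period Y p k.+1 -> p <= last_border Y k].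
Proof.
have nonempty : 0 < #|[pred p : 'I_k.+1 | period Y p k.+1]|.
  by apply/card_gt0P; exists ord0; rewrite inE; apply/periodP.
have max p : p <= k -> period Y p k.+1 -> p <= last_border Y k.
  by rewrite -ltnS => lt; apply: (leq_bigmax_cond (Ordinal lt)).
case: (eq_bigmax_cond (fun p : 'I_k.+1 => p : nat) nonempty) => p.
rewrite inE => per eq; have {}eq : last_border Y k = p by [].
by split; rewrite // eq // -ltnS.
Qed.

Lemma last_border_eq Y k s : s <= k -> period Y s k.+1 ->
  (forall p, p <= k -> period Y p k.+1 -> p <= s) -> last_border Y k = s.
Proof.
move=> le per max; have [le' per' max'] := last_borderP Y k.
by apply/eqP; rewrite eqn_leq max // max'.
Qed.

(** Ensures that the descent from [m] to the boundary below it never jumps past [last_border Y j]: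
    that period restricts to the shorter prefix. *)
Lemma last_border_mono Y j m : last_border Y j < m <= j -> last_border Y j <= last_border Y m.-1.
Proof.
move=> /andP [lt le]; have [_ perj _] := last_borderP Y j.
have [_ _ max] := last_borderP Y m.-1.
by apply: max; [lia|apply: period_sub perj; lia].
Qed.

(** Justifies copying [lyns[i]] into [lyns[j]]. With [i = j %% p], the letters at [j - i .. j]
    repeat those at [0 .. i], so shifting by [j - i] matches the periods of [Y 0 .. Y i] with those
    of [Y 0 .. Y j] that are at least [j - i]. *)
Lemma last_border_mod Y p j : 0 < p <= j -> period Y p j.+1 ->
  last_border Y j = j - j %% p + last_border Y (j %% p).
Proof.
move=> bp per; set i := j %% p.
have lei : i <= j by exact: leq_mod.
have [les pers maxs] := last_borderP Y i.
have shift x : x <= i -> Y (j - i + x) = Y x.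
  move=> lex; rewrite (period_mod _ per); [|lia..].
  rewrite [RHS](period_mod _ per); [|lia..].
  by rewrite /i {1}(divn_eq j p) addnK modnMDl.
have ltp : i < p by rewrite ltn_mod; lia.
apply: last_border_eq; first lia.
  apply/periodP => t ltt; rewrite -addnA shift; last lia.
  by move/periodP: pers; apply; lia.
move=> q leq /periodP perq; have [|ltq] := leqP q (j - i); first lia.
suff h : period Y (q - (j - i)) i.+1 by have := maxs _ _ h; lia.
apply/periodP => t ltt; rewrite -[RHS]perq; last lia.
by rewrite -shift; [congr Y; lia|lia].
Qed.

(** A period [q] of the shortest border would yield a shorter one, starting [q] positions later. *)
Lemma last_border_unbordered Y k q : 0 < q -> last_border Y k + q <= k ->
  ~~ period Y q (k.+1 - last_border Y k).
Proof.
move=> q0 le; have [_ /periodP per max] := last_borderP Y k.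
apply/negP => /periodP perq; suff /(max _ le) : period Y (last_border Y k + q) k.+1 by lia.
by apply/periodP => t lt; rewrite -addnA per ?perq //; lia.
Qed.

(** The size condition excludes that [u] is a proper prefix of [v], so only a first mismatch inside
    [v] remains. It will be used with [v] a suffix of [u]. *)
Lemma lexlt_shorter x0 u v : size v <= size u ->
  reflect (exists t, [/\ t < size v, forall r, r < t -> nth x0 u r = nth x0 v r &
                       (nth x0 u t < nth x0 v t)%O])
          (lexlt u v).
Proof.
elim: u v => [|a u IH] [|b v] //= le.
- by constructor; case=> t [].
- by constructor; case=> t [].
have [ltab|ltba|->] /= := ltgtP a b.
- by constructor; exists 0.
- constructor; case=> [[|t] [/= ltt eqr lt]]; first by have := lt_trans lt ltba; rewrite ltxx.
  by have := eqr 0 isT => /= eqab; rewrite eqab ltxx in ltba.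
apply: (iffP (IH _ le)) => [[t [ltt eqr lt]]|[[|t] [/= ltt eqr lt]]].
- by exists t.+1; split=> // [[|r]] //= /eqr.
- by rewrite ltxx in lt.
by exists t; split=> // r ltr; apply: (eqr r.+1).
Qed.

Lemma lyndonP x0 w :
  reflect (0 < size w /\ forall m, 0 < m < size w ->
             exists t, [/\ m + t < size w, forall r, r < t -> nth x0 w r = nth x0 w (m + r) &
                         (nth x0 w t < nth x0 w (m + t))%O])
          (lyndon w).
Proof.
apply: (iffP andP) => -[w0 h]; split=> //.
  move=> m bm; have mem : m \in iota 1 (size w).-1 by rewrite mem_iota; lia.
  have /(lexlt_shorter x0) := allP h m mem; rewrite size_drop => /(_ ltac:(lia)) [t [ltt eqr lt]].
  exists t; split; first lia; last by rewrite -nth_drop.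
  by move=> r /eqr; rewrite nth_drop.
apply/allP => m; rewrite mem_iota => bm.
have [|t [ltt eqr lt]] := h m; first lia.
apply/(lexlt_shorter x0); rewrite size_drop; first lia.
exists t; split; first lia; last by rewrite nth_drop.
by move=> r /eqr; rewrite nth_drop.
Qed.

Lemma lyndon_unbordered x0 w q : lyndon w -> 0 < q < size w ->
  ~~ period (nth x0 w) q (size w).
Proof.
move=> /(lyndonP x0) [_ h] /h [t [lt _ neq]]; apply/negP => /periodP /(_ t lt) eq.
by rewrite eq ltxx in neq.
Qed.

End Periods.

(** * Borders and infinite powers of the prefixes of a Lyndon word *)

Section LyndonWord.
Variables (d : Order.disp_t) (T : orderType d) (x0 : T) (y : seq T).
Hypothesis lyn : lyndon y.
Local Notation n := (size y).
Local Notation Y := (nth x0 y).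
Local Notation border := (last_border Y).

(** The first difference between the suffix at [m] and [y] cannot precede [i]; if it comes after
    [i], the letters at [i] agree. *)
Lemma lyndon_suffix m i : m + i < n ->
  (forall r, r < i -> Y (m + r) = Y r) -> (Y i <= Y (m + i))%O.
Proof.
move=> lt eqr; have [->|m0] := posnP m; first by rewrite lexx.
have /(lyndonP x0) [_ /(_ m)] := lyn; case; first lia.
move=> t [ltt eqr' ltY]; have [lti|lti|eq] := ltngtP t i.
- by rewrite eqr ?ltxx in ltY.
- by rewrite eqr'.
by rewrite -eq ltW.
Qed.

Lemma lyndon_mismatch m i : m + i < n ->
  (forall r, r < i -> Y (m + r) = Y r) -> Y (m + i) <> Y i -> (Y i < Y (m + i))%O.
Proof.
move=> lt eqr neq; rewrite lt_neqAle lyndon_suffix // andbT eq_sym.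
exact/eqP.
Qed.

(* The border starting at [m] meets the one starting at [s]; a first mismatch past [s]
   would give a suffix of [y] smaller than [y]. *)
Lemma period_trans m s k : m < s -> k <= n ->
  period Y m s -> period Y s k -> period Y m k.
Proof.
move=> ltms le /periodP perm /periodP pers; apply/negPn/negP => /periodPn [t [lt eqr neq]].
have ltY := lyndon_mismatch (leq_trans lt le) eqr neq.
have [lts|les] := ltnP (m + t) s; first by case: neq; apply: perm.
pose r := m + t - s.
have eqt : t = (s - m) + r by rewrite /r; lia.
have eqmt : m + t = s + r by rewrite /r; lia.
have : (Y r <= Y ((s - m) + r))%O.
  apply: lyndon_suffix; first by rewrite -eqt; lia.
  move=> r' ltr'; rewrite -eqr -?eqt; last by lia.
  by rewrite (_ : m + _ = s + r') ?pers //; lia.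
by rewrite -eqt -pers -?eqmt // leNgt ltY.
Qed.

(** The factor is a copy of a prefix of [y] without proper border, so each of its proper suffixes
    has a mismatch with it, and the first one goes upwards by [lyndon_mismatch]. *)
Lemma factor_lyndon a b : 0 < b -> a + b <= n ->
  (forall t, t < b -> Y (a + t) = Y t) ->
  (forall q, 0 < q < b -> ~~ period Y q b) -> lyndon (take b (drop a y)).
Proof.
move=> b0 le eqr unb.
have sz : size (take b (drop a y)) = b by rewrite size_takel // size_drop; lia.
have nthE t : t < b -> nth x0 (take b (drop a y)) t = Y t.
  by move=> lt; rewrite nth_take // nth_drop eqr.
apply/(lyndonP x0); rewrite sz; split=> // q bq.
have /periodPn [t [lt eqt neq]] := unb q bq.
exists t; split=> //; last by rewrite !nthE; [apply: lyndon_mismatch => //; lia|lia..].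
by move=> r ltr; rewrite !nthE ?eqt //; lia.
Qed.

Lemma last_border_lyndon k : k < n ->
  lyndon (take (k.+1 - border k) (drop (border k) y)).
Proof.
move=> lt; have [le /periodP per max] := last_borderP Y k.
apply: factor_lyndon; [lia|lia| |].
  by move=> t ltt; apply: per; lia.
by move=> q /andP [q0 ltq]; apply: last_border_unbordered => //; lia.
Qed.

Lemma last_border_last : border n.-1 = 0.
Proof.
have /(lyndonP x0) [n0 _] := lyn; have [le per max] := last_borderP Y n.-1.
apply/eqP; rewrite eqn0Ngt; apply/negP => gt0.
have /negP[] := lyndon_unbordered x0 lyn (q := border n.-1) ltac:(lia).
by rewrite -(prednK n0).
Qed.

Lemma inf_at_take m i : 0 < m <= n -> inf_at (take m y) i = Some (Y (i %% m)).
Proof.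
move=> /andP [m0 le]; rewrite /inf_at size_takel // onthE map_take nth_take ?ltn_pmod //.
by rewrite (nth_map x0) // (leq_trans _ le) // ltn_pmod.
Qed.

(** Both powers follow [y] up to the first failure of the period [m]; there the first keeps the old
    letter and the second takes the larger letter of [y]. *)
Lemma inf_lt_period m m' j : 0 < m <= n -> 0 < m' <= n -> j <= n ->
  ~~ period Y m j -> period Y m' j -> inf_lt (take m y) (take m' y).
Proof.
move=> bm bm' le /periodPn [t [lt eqr neq]] perm'.
have ltY := lyndon_mismatch (leq_trans lt le) eqr neq.
have perm : period Y m (m + t) by apply/periodP => r ltr; apply: eqr; lia.
exists (m + t); split=> [i lti|].
  rewrite !inf_at_take // -(period_mod _ perm) //; last lia.
  by rewrite -(period_mod _ perm') //; lia.
exists (Y t), (Y (m + t)); split; last split=> //; rewrite !inf_at_take //.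
  by rewrite modnDl -(period_mod _ perm) //; lia.
by rewrite -(period_mod _ perm') //; lia.
Qed.

(* Write [take m y = x'^e r] with [x' = take m' y = r s]; the two infinite words first
   compare [rs] with [sr], and [sr] is a factor of [y], hence not below the prefix [rs]. *)
Lemma prec_period m m' : 0 < m' < m -> m <= n -> period Y m' m ->
  prec (take m y) (take m' y).
Proof.
move=> bm le per; pose r := m %% m'.
have ltr : r < m' by rewrite ltn_mod; lia.
have ler : m' + r <= m.
  by rewrite [X in _ <= X](divn_eq m m') leq_add2r leq_pmull // divn_gt0; lia.
have modE t : t < m' -> Y ((m + t) %% m') = Y (r + t).
  by move=> lt; rewrite -modnDml -(period_mod _ per) //; lia.
have small i : i < m -> Y (i %% m) = Y (i %% m').
  by move=> lt; rewrite modn_small // -(period_mod _ per) //; lia.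
(* The case [rs = sr], which includes [r = 0]: the powers coincide and the lengths decide. *)
have [perr|] := boolP (period Y r (r + m')).
  right; rewrite !size_takel; [|lia..]; split; last lia.
  have shift i : Y ((r + i) %% m') = Y (i %% m').
    have lti : i %% m' < m' by rewrite ltn_mod; lia.
    rewrite -modnDmr -(period_mod (n := m)) //; [|lia..].
    by move/periodP: perr; apply; lia.
  have shiftm q i : Y ((q * m + i) %% m') = Y (i %% m').
    elim: q => [|q IH]; first by rewrite mul0n.
    by rewrite mulSn -addnA -modnDml shift.
  move=> i; rewrite !inf_at_take; [|lia..]; congr Some.
  rewrite -(modn_mod i m) small; last by rewrite ltn_mod; lia.
  by rewrite [in RHS](divn_eq i m) shiftm.
move=> /periodPn [t [lt eqr neq]]; left; exists (m + t); split=> [i lti|].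
  rewrite !inf_at_take; [|lia..]; congr Some.
  have [/small //|lemi] := ltnP i m.
  have := modE (i - m); rewrite subnKC // => ->; last lia.
  rewrite eqr; last lia.
  by rewrite -{1}(subnKC lemi) modnDl modn_small //; lia.
exists (Y t), (Y (r + t)); split; last split.
- by rewrite inf_at_take; [congr (Some (Y _)); rewrite modnDl modn_small; lia|lia].
- by rewrite inf_at_take; [rewrite modE //; lia|lia].
by apply: lyndon_mismatch => //; lia.
Qed.

(** Justifies the reset of [per] to [j.+1]. A period [q < p] contradicts [unb], and [q = p] the
    mismatch. If [q > p], the suffix at [q - p] agrees with [y] for [j - q] letters and then has
    [Y (j - p)], smaller than [Y j = Y (j - q)]. *)
Lemma mismatch_unbordered p j : 0 < p <= j -> j < n -> period Y p j ->
  (forall q, 0 < q < p -> ~~ period Y q p) -> Y j <> Y (j %% p) ->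
  forall q, 0 < q <= j -> ~~ period Y q j.+1.
Proof.
move=> bp lt per unb neq q bq; apply/negP => perq.
have perqP := elimT (periodP _ _ _) perq; have perP := elimT (periodP _ _ _) per.
have eqjp : Y (j %% p) = Y (j - p).
  rewrite [RHS](period_mod _ per); [|lia..]; congr Y.
  by rewrite -[in LHS](subnK (m := p) (n := j)) ?modnDr //; lia.
have ltY : (Y (j - p) < Y j)%O.
  have jE : j = p + (j - p) by lia.
  rewrite [X in (_ < Y X)%O]jE; apply: lyndon_mismatch; first lia.
    by move=> r ltr; apply: perP; lia.
  by rewrite -jE -eqjp.
have eqq : Y j = Y (j - q) by rewrite -(perqP (j - q)) ?subnKC //; lia.
have [ltqp|ltpq|eqpq] := ltngtP q p.
- by have := unb q; rewrite (period_sub _ perq); lia.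
- have := lyndon_suffix (m := q - p) (i := j - q).
  rewrite (_ : q - p + (j - q) = j - p); last lia.
  rewrite -eqq leNgt ltY => h; suff : false by []; apply: h; first lia.
  move=> r ltr; rewrite -[RHS]perqP; last lia.
  by rewrite -perP; [congr Y; lia|lia].
by rewrite eqq eqpq ltxx in ltY.
Qed.

End LyndonWord.

(** * Left Lyndon trees and the prefixes associated with their nodes *)

Section Trees.
Variables (d : Order.disp_t) (T : orderType d).
Implicit Types w : seq T.

Definition split_length (t : tree) : nat :=
  if t is Node l _ then (rightmost l).+1 else 0.

Lemma assoc_prefixE w t : assoc_prefix w t = take (split_length t) w.
Proof. by case: t => //= i; rewrite take0. Qed.

Lemma longest_lyndon_prefix_bounds w : 1 < size w ->
  0 < longest_lyndon_prefix w < size w.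
Proof.
case: w => [|a [|b w]] // _; apply/andP; split.
  by apply: (@bigmaxn_sup_seq _ _ 1); rewrite ?mem_index_iota //= /lyndon /= take0.
rewrite /longest_lyndon_prefix -[X in _ < X](prednK (n := size _)) // ltnS.
by apply/bigmax_leqP_seq => m; rewrite mem_index_iota; lia.
Qed.

Lemma longest_lyndon_prefix_eq w m : 0 < m < size w -> lyndon (take m w) ->
  (forall t, m < t < size w -> ~~ lyndon (take t w)) -> longest_lyndon_prefix w = m.
Proof.
move=> bm lynm max; apply/eqP; rewrite eqn_leq; apply/andP; split.
  apply/bigmax_leqP_seq => t; rewrite mem_index_iota => bt lynt.
  by rewrite leqNgt; apply: contraTN lynt => lt; apply: max; lia.
by apply: (@bigmaxn_sup_seq _ _ m); rewrite ?mem_index_iota.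
Qed.

Lemma llt_rec_fuel f f' off w : size w <= f -> size w <= f' ->
  llt_rec f off w = llt_rec f' off w.
Proof.
elim: f f' off w => [|f IH] [|f'] off w //=.
- by rewrite leqn0 => /eqP ->.
- by move=> _; rewrite leqn0 => /eqP ->.
move=> le le'; case: leqP => // /longest_lyndon_prefix_bounds bm.
by congr Node; apply: IH; rewrite ?size_takel ?size_drop; lia.
Qed.

Definition llt off w : tree := llt_rec (size w) off w.

Lemma llt_leaf off w : size w <= 1 -> llt off w = Leaf off.
Proof. by rewrite /llt; case: w => [|a []]. Qed.

Lemma llt_node off w (m := longest_lyndon_prefix w) : 1 < size w ->
  llt off w = Node (llt off (take m w)) (llt (off + m) (drop m w)).
Proof.
move=> lt; have bm : 0 < m < size w := longest_lyndon_prefix_bounds lt.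
rewrite {1}/llt; case sz: (size w) => [|f] /=; first lia.
rewrite leqNgt lt /= -/m; congr Node; apply: llt_rec_fuel;
  by rewrite ?size_takel ?size_drop; lia.
Qed.

(** The left subtree accounts for the lengths below [off + m], the root for [off + m] and the right
    subtree for those above; this is the bijection with the proper non-empty prefixes. *)
Lemma llt_positions off w : 0 < size w ->
  (rightmost (llt off w)).+1 = off + size w /\
  perm_eq (map split_length (internals (llt off w))) (iota off.+1 (size w).-1).
Proof.
have [N] := ubnP (size w); elim: N off w => // N IH off w ltN w0.
have [le|lt] := leqP (size w) 1.
  rewrite llt_leaf //; suff -> : size w = 1 by rewrite addn1.
  by lia.
rewrite llt_node //; set m := longest_lyndon_prefix w.
have bm : 0 < m < size w := longest_lyndon_prefix_bounds lt.
have szt : size (take m w) = m by rewrite size_takel; lia.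
have szd : size (drop m w) = size w - m by rewrite size_drop.
have [||rl perml] := IH off (take m w); [rewrite szt; lia..|].
have [||rr permr] := IH (off + m) (drop m w); [rewrite szd; lia..|].
rewrite szt in rl perml; rewrite szd in rr permr; split; first by rewrite /= rr; lia.
rewrite /= map_cat rl.
have -> : (size w).-1 = m.-1 + (1 + (size w - m).-1) by lia.
rewrite iotaD (iotaD _ 1) /= (_ : off.+1 + m.-1 = off + m); last lia.
by rewrite addn1 -cat1s perm_catCA perm_cat // cat1s perm_cons.
Qed.

End Trees.

(** * Invariants of the algorithm *)

Section Algorithm.
Variables (d : Order.disp_t) (T : orderType d) (x0 : T) (y : seq T).
Hypothesis lyn : lyndon y.
Local Notation n := (size y).
Local Notation Y := (nth x0 y).
Local Notation border := (last_border Y).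

Definition factor_tree a b : tree := llt a (take (b - a) (drop a y)).
(** The tree of the longest Lyndon suffix of [y[0..k]], which is the final value of [root[k]]. *)
Definition suffix_tree k : tree := factor_tree (border k) k.+1.

Lemma size_factor a b : b <= n -> size (take (b - a) (drop a y)) = b - a.
Proof. by move=> le; rewrite size_takel // size_drop; lia. Qed.

Lemma factor_tree_leaf k : k < n -> factor_tree k k.+1 = Leaf k.
Proof. by move=> lt; rewrite /factor_tree llt_leaf // size_factor; lia. Qed.

Lemma rightmost_suffix_tree k : k < n -> rightmost (suffix_tree k) = k.
Proof.
move=> lt; have [le _ _] := last_borderP Y k.
have := llt_positions (border k) (w := take (k.+1 - border k) (drop (border k) y)).
by rewrite size_factor // /suffix_tree /factor_tree => /(_ ltac:(lia)) [eq _]; lia.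
Qed.

(* The longest proper Lyndon prefix of [y[a..j]] ends just before [p]: any longer proper
   prefix is, by the two periods [a] and [p], a bordered prefix of [y]. *)
Lemma factor_tree_node p j (a := border p.-1) : 0 < p <= j -> j < n -> period Y p j ->
  factor_tree a j.+1 = Node (suffix_tree p.-1) (factor_tree p j.+1).
Proof.
move=> bp lt perp; have [lea pera _] := last_borderP Y p.-1; rewrite -/a in lea pera.
have eqp : p.-1.+1 = p by lia.
rewrite eqp in pera; have perj : period Y a j.
  by apply: (period_trans lyn (s := p)) => //; lia.
rewrite /suffix_tree eqp -/a /factor_tree; set w := take (j.+1 - a) _.
have sz : size w = j.+1 - a by apply: size_factor.
have takeE t : t <= j.+1 - a -> take t w = take t (drop a y).
  by move=> le; rewrite /w take_takel.
have longest : longest_lyndon_prefix w = p - a.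
  apply: longest_lyndon_prefix_eq; rewrite ?sz; first lia.
    rewrite takeE; last lia.
    by have := last_border_lyndon x0 lyn (k := p.-1) ltac:(lia); rewrite eqp.
  move=> t bt; rewrite takeE; last lia.
  have szt : size (take t (drop a y)) = t by rewrite size_takel // size_drop; lia.
  apply/negP => lynt; have /negP[] := lyndon_unbordered x0 lynt (q := p - a) ltac:(lia).
  rewrite szt.
  apply/periodP => r ltr; rewrite !nth_take ?nth_drop; [|lia..].
  have -> : a + (p - a + r) = p + r by lia.
  by rewrite (elimT (periodP _ _ _) perp) ?(elimT (periodP _ _ _) perj) //; lia.
rewrite llt_node ?sz; last lia.
rewrite longest takeE; last lia.
rewrite (_ : a + (p - a) = p); last lia.
congr (Node _ (llt _ _)).
by rewrite /w !take_drop drop_drop; congr (drop _ (take _ _)); lia.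
Qed.

(* Internal nodes of the trees on the Lyndon factorization of a prefix of [y]. *)
Inductive forest : nat -> seq tree -> Prop :=
| forest0 : forest 0 [::]
| forestS k s : forest (border k) s -> forest k.+1 (internals (suffix_tree k) ++ s).

Lemma forest_inv m s : 0 < m -> forest m s ->
  exists2 s', forest (border m.-1) s' & s = internals (suffix_tree m.-1) ++ s'.
Proof. by move=> m0 fs; case: fs m0 => // k s' fs' _; exists s'. Qed.

(** In the second clause, the left alternative covers the nodes of earlier steps, whose powers [y]
    has already left, and the right one those created in step [j], at boundaries above the current
    [m]. *)
Definition created_inv m j (cr : seq tree) : Prop :=
  (forall i1 i2, i1 < i2 < size cr ->
     prec (take (split_length (nth (Leaf 0) cr i1)) y)
          (take (split_length (nth (Leaf 0) cr i2)) y)) /\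
  {in cr, forall q, 0 < split_length q <= j /\
     (~~ period Y (split_length q) j \/ m < split_length q)}.

(** The new node exceeds the nodes of earlier steps by [inf_lt_period], and those of the current
    step, with longer prefixes, by [prec_period]. *)
Lemma created_inv_rcons m m' j cr q : j < n -> 0 < m <= j -> period Y m j ->
  m' < m -> split_length q = m -> created_inv m j cr -> created_inv m' j (rcons cr q).
Proof.
move=> lt bm per ltm eqm [incr bnd]; split=> [i1 i2|q'].
  rewrite size_rcons => lti; rewrite !nth_rcons.
  have lti1 : i1 < size cr by lia.
  rewrite lti1.
  have [lti2|lei2] := ltnP i2 (size cr); first by apply: incr; lia.
  have -> : i2 == size cr by apply/eqP; lia.
  rewrite eqm; have mem : nth (Leaf 0) cr i1 \in cr by rewrite mem_nth.
  have [bs [nper|gt]] := bnd _ mem.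
    by left; apply: (inf_lt_period lyn (j := j)) => //; lia.
  apply: (prec_period lyn); [lia|lia|].
  by apply: period_sub per; lia.
rewrite mem_rcons inE => /predU1P [->|mem]; first by rewrite eqm; split=> //; right.
by have [bs [nper|gt]] := bnd _ mem; split=> //; [left|right; lia].
Qed.

(** A length above [border j] is not a period of [y[0..j]], by maximality of [border j]. *)
Lemma created_inv_next j cr :
  created_inv (border j) j cr -> created_inv j.+1 j.+1 cr.
Proof.
move=> [incr bnd]; split=> // q mem; have [_ _ max] := last_borderP Y j.
have [bs h] := bnd _ mem; split; first lia.
left; apply/negP => per; case: h => [/negP[]|gt]; first exact: period_sub per.
by have := max _ _ per; lia.
Qed.

(* [m] is the left end of the factor spanned by [root j]. *)
Lemma while_loop_inv lyns j : j < n ->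
  (forall k, k <= j -> lyns k = k.+1 - border k) ->
  forall fuel m root cr s, border j <= m <= j -> m < fuel -> period Y m j ->
  (forall k, k < j -> root k = suffix_tree k) -> root j = factor_tree m j.+1 ->
  forest m s -> perm_eq cr (internals (root j) ++ s) -> created_inv m j cr ->
  let: (root', cr') := while_loop fuel lyns root j (j.+1 - m) m.-1 cr in
  [/\ forall k, k <= j -> root' k = suffix_tree k,
      exists2 s', forest j.+1 s' & perm_eq cr' s' & created_inv j.+1 j.+1 cr'].
Proof.
move=> lt lynsE; elim=> // fuel IH m root cr s bm ltm per rootE rootj fs perm inv /=.
have [_ perb maxb] := last_borderP Y j.
rewrite lynsE //; case: ifP => [ltl|gel].
  have ltbm : border j < m by lia.
  have [leb perm' _] := last_borderP Y m.-1; have eqm : m.-1.+1 = m by lia.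
  rewrite lynsE; last lia.
  rewrite (_ : j.+1 - m + _ = j.+1 - border m.-1); last lia.
  (* When [border m.-1 = 0] both sides are truncated to 0, where the algorithm would have
     [k = -1]. *)
  rewrite (_ : m.-1 - _ = (border m.-1).-1); last lia.
  have nodeE := factor_tree_node (p := m) (j := j) ltac:(lia) lt per.
  have rootm : root m.-1 = suffix_tree m.-1 by apply: rootE; lia.
  have [s' fs' es] := forest_inv (m := m) ltac:(lia) fs.
  have mono := last_border_mono (Y := Y) (j := j) (m := m) ltac:(lia).
  apply: (IH _ _ _ s'); [lia|lia| | | |by []| |].
  - by apply: (period_trans lyn (s := m)) => //; [lia|lia|rewrite -{2}eqm].
  - by move=> k ltk; rewrite /upd ltn_eqF // rootE.
  - by rewrite /upd eqxx nodeE rootm rootj.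
  - rewrite /upd eqxx /= -cats1 perm_catC /= perm_cons.
    by apply: (perm_trans perm); rewrite es -rootm -catA perm_catCA.
  apply: created_inv_rcons inv => //; [lia|lia|].
  by rewrite /= rootm rightmost_suffix_tree //; lia.
(* The loop stops exactly when [root j] spans the longest Lyndon suffix of [y[0..j]]. *)
have eqb : m = border j by lia.
split; last by apply: created_inv_next; rewrite -eqb.
  by move=> k; rewrite leq_eqVlt => /predU1P [->|/rootE //]; rewrite rootj eqb.
exists (internals (suffix_tree j) ++ s); first by constructor; rewrite -eqb.
by rewrite /suffix_tree -eqb -rootj.
Qed.

(** The conditions on [per] make it the smallest positive period of [y[0..j-1]]: a smaller one would
    restrict to the prefix of length [per]. *)
Definition alg_inv j (st : alg_state) : Prop :=
  let: AlgState lyns root per i cr := st in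
  [/\ [/\ 0 < per <= j, forall q, 0 < q < per -> ~~ period Y q per,
          period Y per j & i = j %% per],
      forall k, k < j -> lyns k = k.+1 - border k,
      forall k, k < j -> root k = suffix_tree k,
      exists2 s, forest j s & perm_eq cr s &
      created_inv j j cr].

Lemma alg_step_inv j st : 0 < j < n -> alg_inv j st -> alg_inv j.+1 (alg_step y st j).
Proof.
case: st => lyns root p i cr bj [[bp unb per ->] lynsE rootE [s fs perm] inv] /=.
have [j0 lt] := andP bj; have ltp : j %% p < p by rewrite ltn_mod; lia.
have onthY k : k < n -> onth y k = Some (Y k).
  by move=> ltk; rewrite onthE (nth_map x0).
rewrite !onthY; [|lia..]; rewrite (inj_eq Some_inj).
set res := (if _ then _ else _).
suff [lyns' [p' [i' [-> [bp' unb' per' i'E] lyns'E]]]] :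
    exists lyns' p' i', [/\ res = (lyns', p', i'),
      [/\ 0 < p' <= j.+1, forall q, 0 < q < p' -> ~~ period Y q p',
          period Y p' j.+1 & i' = j.+1 %% p'] &
      forall k, k <= j -> lyns' k = k.+1 - border k].
  have [leb _ _] := last_borderP Y j.
  (* The loop starts with [root j] a leaf, hence at the boundary [m = j], where
     [l = j.+1 - m = 1]. *)
  have := while_loop_inv lt lyns'E (fuel := j.+1) (m := j)
    (root := upd root j (Leaf j)) (cr := cr) (s := s).
  rewrite subSnn leb leqnn /= => /(_ isT (ltnSn j)).
  case: (if _ then _ else _) => root' cr' [] //.
  - by apply/periodP => t; lia.
  - by move=> k ltk; rewrite /upd ltn_eqF // rootE.
  - by rewrite /upd eqxx factor_tree_leaf.
  - by rewrite /upd eqxx.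
rewrite /res; case: eqP => /= [eqY|neqY].
  have per' : period Y p j.+1.
    apply/periodP => t ltt; have [ltj|gej] := ltnP (p + t) j.
      by move/periodP: per; apply.
    have ej : p + t = j by lia.
    by rewrite ej eqY [RHS](period_mod _ per) -?ej ?modnDl //; lia.
  exists (upd lyns j (lyns (j %% p))), p, ((j %% p + 1) %% p); split=> //.
    by split=> //; [lia|rewrite modnDml addn1].
  move=> k lek; rewrite /upd; case: eqP => [->|neq]; last by rewrite lynsE //; lia.
  rewrite lynsE; last lia.
  have [leb _ _] := last_borderP Y (j %% p); have := leq_mod j p.
  by rewrite (last_border_mod bp per'); lia.
(* After a mismatch [y[0..j]] has no proper border, so [border j = 0] and [lyns[j]] is the full
   length [j.+1]. *)
have unb' := mismatch_unbordered lyn bp lt per unb neqY.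
exists (upd lyns j j.+1), j.+1, 0; split=> //.
  by rewrite modnn; split; [lia|exact: unb'|apply/periodP => t; lia|].
move=> k lek; rewrite /upd; case: eqP => [->|neq]; last by rewrite lynsE //; lia.
have [leb perb _] := last_borderP Y j.
have [->|b0] := posnP (border j); first by rewrite subn0.
by have := unb' (border j); rewrite perb; lia.
Qed.

Lemma alg_inv_run k : k < n ->
  alg_inv k.+1 (foldl (alg_step y)
    (AlgState (upd (fun _ => 0) 0 1) (upd (fun z => Leaf z) 0 (Leaf 0)) 1 0 [::])
    (iota 1 k)).
Proof.
elim: k => [|k IH] lt.
  have b0 : border 0 = 0 by have [] := last_borderP Y 0; lia.
  have tree0 : suffix_tree 0 = Leaf 0 by rewrite /suffix_tree b0 factor_tree_leaf.
  split=> /=.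
  - by split=> //; [lia|apply/periodP => t; lia].
  - by move=> [|k] //; rewrite /upd b0.
  - by move=> [|k] //; rewrite tree0.
  - exists (internals (suffix_tree 0) ++ [::]); last by rewrite tree0.
    by constructor; rewrite b0; constructor.
  by split=> // i1 i2 /=; lia.
rewrite -[k.+1]addn1 iotaD foldl_cat addn1 add1n /=.
by apply: alg_step_inv; [lia|apply: IH; lia].
Qed.

End Algorithm.

Theorem theorem6 (d : Order.disp_t) (T : orderType d) (y : seq T) :
  lyndon y -> (1 < size y)%N ->
  let res := left_lyndon_tree_alg y in
  let cr := res.2 in
  [/\ res.1 = LLT y,
      size cr = (size y).-1,
      perm_eq cr (internals (LLT y)),
      perm_eq (map (assoc_prefix y) cr) [seq take m y | m <- iota 1 (size y).-1] &
      forall i j, (i < j < size cr)%N ->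
        prec (assoc_prefix y (nth (Leaf 0) cr i)) (assoc_prefix y (nth (Leaf 0) cr j))].
Proof.
move=> lyn lt /=; have x0 : T by case: y lt {lyn}.
rewrite /left_lyndon_tree_alg.
have := alg_inv_run x0 lyn (k := (size y).-1) ltac:(lia).
case: (foldl _ _ _) => lyns root p i cr /= [_ _ rootE [s fs perm] [incr _]].
have b0 := last_border_last x0 lyn.
have treeE : suffix_tree x0 y (size y).-1 = LLT y.
  by rewrite /suffix_tree b0 /factor_tree prednK ?subn0 ?drop0 ?take_size //; lia.
(* As [y] has no proper border, the final forest consists of a single tree. *)
have [s' fs' es] := forest_inv (m := (size y).-1.+1) isT fs.
rewrite /= b0 treeE in fs' es.
have {}es : s = internals (LLT y).
  by rewrite es; inversion fs'; rewrite cats0.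
rewrite es in perm.
have [_ splits] := llt_positions 0 (w := y) ltac:(lia).
have perms : perm_eq (map split_length cr) (iota 1 (size y).-1).
  exact: perm_trans (perm_map _ perm) splits.
split=> //.
- by rewrite rootE.
- by rewrite -(size_map split_length) (perm_size perms) size_iota.
- rewrite (eq_map (assoc_prefixE y)) (map_comp (take^~ y)).
  exact: perm_map.
by move=> i1 i2 lti; rewrite !assoc_prefixE; apply: incr.
Qed.
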